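(* Let $(\Sigma,\partial)$ be a differential field whose field of constants $\mathbf{C}$ is algebraically closed and of characteristic zero, and let $L\in\Sigma[\partial]\setminus\mathbf{C}[\partial]$ be a third order ordinary differential operator (i.e. with non constant coefficients). Then the centralizer $\mathcal{Z}(L)$ of $L$ in $\Sigma[\partial]$ is either isomorphic to a polynomial ring in one variable or isomorphic to the coordinate ring $\mathbf{C}[\Gamma]$ of an irreducible (space) algebraic curve $\Gamma$.
   Context: $\Sigma[\partial]$ is the ring of ordinary differential operators with coefficients in $\Sigma$, with multiplication determined by $\partial a=a\partial+\partial(a)$ for $a\in\Sigma$; $\mathbf{C}[\partial]$ is the subring of operators with constant coefficients. The centralizer of $L$ is $\mathcal{Z}(L)=\{A\in\Sigma[\partial]\mid LA=AL\}$. A space algebraic curve is an algebraic curve in $\mathbf{C}^3$; the polynomial ring in one variable is over $\mathbf{C}$. *)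

(* Defs.v *)
From HB Require Import structures.
From mathcomp Require Import all_boot all_algebra.
From mathcomp Require Import boolp classical_sets.
From mathcomp Require Import mpoly.

Set Implicit Arguments.
Unset Strict Implicit.
Unset Printing Implicit Defensive.

Import GRing.Theory.

Local Open Scope ring_scope.

HB.mixin Record hasDerivation K of GRing.Field K := {
  der : K -> K;
  derD : {morph der : a b / a + b};
  derM : forall a b, der (a * b) = der a * b + a * der b
}.

#[short(type="diffFieldType")]
HB.structure Definition DiffField := {K of GRing.Field K & hasDerivation K}.

Section Constants.
Variable K : diffFieldType.
Implicit Types a b : K.

Lemma der0 : der (0 : K) = 0.
Proof. by apply: (addrI (der 0)); rewrite -derD !addr0. Qed.

Lemma derN a : der (- a) = - der a.
Proof. by apply: (addrI (der a)); rewrite -derD !subrr der0. Qed.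

Lemma derB a b : der (a - b) = der a - der b.
Proof. by rewrite derD derN. Qed.

HB.instance Definition _ := GRing.isZmodMorphism.Build K K der derB.

Lemma der1 : der (1 : K) = 0.
Proof.
by apply: (addrI (der 1)); rewrite addr0 -{3}(mulr1 1) derM mulr1 mul1r.
Qed.

Definition constant_pred : {pred K} := [pred a | der a == 0].

Lemma constant_closed : divring_closed constant_pred.
Proof.
split=> [|a b|a b]; rewrite ?inE.
- by rewrite der1.
- by move=> /eqP da /eqP db; rewrite derB da db subrr.
move=> /eqP da /eqP db.
have [->|b0] := eqVneq b 0; first by rewrite invr0 mulr0 der0.
have : der (a / b * b) = 0 by rewrite divfK.
by rewrite derM db mulr0 addr0 => /eqP; rewrite mulf_eq0 (negPf b0) orbF.
Qed.

HB.instance Definition _ :=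
  GRing.isDivringClosed.Build K constant_pred constant_closed.

Record constants := Constants {
  constants_val :> K;
  constants_valP : constants_val \in constant_pred
}.

HB.instance Definition _ := [isSub for constants_val].
HB.instance Definition _ := [Choice of constants by <:].
HB.instance Definition _ := [SubChoice_isSubIntegralDomain of constants by <:].
HB.instance Definition _ := [SubIntegralDomain_isSubField of constants by <:].

End Constants.

(* The operator sum_i a_i D^i is stored as the polynomial sum_i a_i X^i; the
   product below is not the product of polynomials. *)
Definition odo (K : diffFieldType) := {poly K}.

HB.instance Definition _ (K : diffFieldType) := GRing.Zmodule.on (odo K).

Section Operators.
Variable K : diffFieldType.
Implicit Types (a : K) (A B : {poly K}).

(* D (sum_i b_i D^i) = sum_i b_i D^(i+1) + sum_i der(b_i) D^i *)
Definition odo_lmulD B : {poly K} := B * 'X + map_poly der B.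

Definition odo_mul A B : {poly K} :=
  \sum_(i < size A) A`_i *: iter i odo_lmulD B.

Definition odo_D : odo K := 'X.
Definition odo_const (a : K) : odo K := a%:P.

Lemma odo_mulE n A B : (size A <= n)%N ->
  odo_mul A B = \sum_(i < n) A`_i *: iter i odo_lmulD B.
Proof.
move=> le_n; rewrite /odo_mul.
rewrite (big_ord_widen n (fun i => A`_i *: iter i odo_lmulD B) le_n) big_mkcond.
apply: eq_bigr => i _; case: ltnP => // /(nth_default _) ->.
by rewrite scale0r.
Qed.

Lemma odo_mulDl : left_distributive odo_mul +%R.
Proof.
move=> A B E; pose n := maxn (size A) (size B).
rewrite (@odo_mulE n (A + B)) ?size_polyD // (@odo_mulE n A) ?leq_maxl //.
rewrite (@odo_mulE n B) ?leq_maxr // -big_split /=.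
by apply: eq_bigr => i _; rewrite coefD scalerDl.
Qed.

Lemma odo_lmulDD A B : odo_lmulD (A + B) = odo_lmulD A + odo_lmulD B.
Proof. by rewrite /odo_lmulD raddfD /= mulrDl addrACA. Qed.

Lemma odo_lmulDZ a B : odo_lmulD (a *: B) = a *: odo_lmulD B + der a *: B.
Proof.
apply/polyP => i; rewrite /odo_lmulD !(coefD, coefZ, coefMX, coef_map) /=.
by rewrite derM mulrDr; case: i => [|i] /=;
  rewrite ?mulr0 -?addrA ?(addrC (der a * _)).
Qed.

Lemma iter_odo_lmulDD i A B :
  iter i odo_lmulD (A + B) = iter i odo_lmulD A + iter i odo_lmulD B.
Proof. by elim: i => //= i ->; rewrite odo_lmulDD. Qed.

Lemma odo_mulDr : right_distributive odo_mul +%R.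
Proof.
move=> A B E; rewrite /odo_mul -big_split; apply: eq_bigr => i _ /=.
by rewrite iter_odo_lmulDD scalerDr.
Qed.

Lemma odo_mulZl a A B : odo_mul (a *: A) B = a *: odo_mul A B.
Proof.
rewrite (odo_mulE _ (size_scale_leq a A)) scaler_sumr.
by apply: eq_bigr => i _; rewrite coefZ scalerA.
Qed.

Lemma odo_mul0l B : odo_mul 0 B = 0.
Proof. by rewrite /odo_mul size_poly0 big_ord0. Qed.

Lemma odo_mul_suml I r (F : I -> {poly K}) B :
  odo_mul (\sum_(i <- r) F i) B = \sum_(i <- r) odo_mul (F i) B.
Proof.
by elim/big_rec2: _ => [|i x y _ <-]; rewrite ?odo_mul0l ?odo_mulDl.
Qed.

Lemma odo_mulXn n B : odo_mul 'X^n B = iter n odo_lmulD B.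
Proof.
rewrite (@odo_mulE n.+1) ?size_polyXn // big_ord_recr /= coefXn eqxx scale1r.
rewrite big1 ?add0r // => i _.
by rewrite coefXn (ltn_eqF (ltn_ord i)) scale0r.
Qed.

Lemma odo_lmulD0 : odo_lmulD 0 = 0.
Proof. by rewrite /odo_lmulD raddf0 mul0r addr0. Qed.

Lemma odo_lmulDXn n : odo_lmulD 'X^n = 'X^(n.+1).
Proof.
rewrite /odo_lmulD -exprSr -[RHS]addr0; congr (_ + _).
apply/polyP => j; rewrite coef_map /= coefXn coef0.
by case: eqP => _; rewrite ?der1 ?der0.
Qed.

Lemma odo_mul_lmulD A B : odo_mul (odo_lmulD A) B = odo_lmulD (odo_mul A B).
Proof.
rewrite -[A]coefK poly_def.
have sumD n (F : 'I_n -> {poly K}) :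
    odo_lmulD (\sum_i F i) = \sum_i odo_lmulD (F i).
  by elim/big_rec2: _ => [|i x y _ <-]; rewrite ?odo_lmulD0 ?odo_lmulDD.
rewrite sumD !odo_mul_suml sumD; apply: eq_bigr => i _.
rewrite odo_lmulDZ odo_mulDl !odo_mulZl odo_lmulDZ; congr (_ *: _ + _).
by rewrite odo_lmulDXn !odo_mulXn.
Qed.

Lemma odo_mulA : associative odo_mul.
Proof.
move=> A B E; rewrite [X in _ = odo_mul X _]/odo_mul odo_mul_suml.
rewrite [LHS]/odo_mul; apply: eq_bigr => i _.
rewrite odo_mulZl; congr (_ *: _).
by elim: (nat_of_ord i) => //= j ->; rewrite odo_mul_lmulD.
Qed.

Lemma odo_mul1l : left_id (1 : {poly K}) odo_mul.
Proof. by move=> B; rewrite -(expr0 'X) odo_mulXn. Qed.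

Lemma odo_mul1r : right_id (1 : {poly K}) odo_mul.
Proof.
move=> A; rewrite -[RHS]coefK poly_def; apply: eq_bigr => i _.
congr (_ *: _); elim: (nat_of_ord i) => //= j ->.
by rewrite odo_lmulDXn.
Qed.

HB.instance Definition _ := GRing.Zmodule_isNzRing.Build (odo K)
  odo_mulA odo_mul1l odo_mul1r odo_mulDl odo_mulDr (@oner_neq0 {poly K}).

Lemma odo_mul_def A B : (A : odo K) * B = odo_mul A B.
Proof. by []. Qed.

Lemma odo_constM a B : (odo_const a : odo K) * B = a *: B :> {poly K}.
Proof.
rewrite odo_mul_def /odo_const -[X in odo_mul X _]mulr1 mul_polyC odo_mulZl.
by rewrite odo_mul1l.
Qed.

Lemma odo_DM B : odo_D * B = odo_lmulD B.
Proof. by rewrite odo_mul_def -[odo_D](expr1 'X) odo_mulXn. Qed.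

Lemma odo_commutation a :
  odo_D * odo_const a = odo_const a * odo_D + odo_const (der a).
Proof.
rewrite odo_DM odo_constM /odo_lmulD /odo_const /odo_D mul_polyC.
by rewrite map_polyC.
Qed.

Lemma odoE (A : odo K) : A = \sum_(i < size A) odo_const A`_i * odo_D ^+ i.
Proof.
have XnE i : odo_D ^+ i = 'X^i :> {poly K}.
  by elim: i => // i IHi; rewrite exprS IHi odo_DM odo_lmulDXn.
rewrite -[LHS]coefK poly_def; apply: eq_bigr => i _.
by rewrite odo_constM XnE.
Qed.

Definition odo_order (A : odo K) := (size A).-1.

Definition constant_operators : {pred odo K} :=
  [pred A : odo K | A \is a polyOver (@constant_pred K)].

(* The constants are central in K[D], so K[D] is an algebra over them. *)
Definition odo_scale (c : constants K) (A : odo K) : odo K :=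
  (c : K) *: (A : {poly K}).

Lemma odo_scaleA c d A : odo_scale c (odo_scale d A) = odo_scale (c * d) A.
Proof. exact: scalerA. Qed.

Lemma odo_scale1 : left_id 1 odo_scale.
Proof. exact: scale1r. Qed.

Lemma odo_scaleDr : right_distributive odo_scale +%R.
Proof. by move=> c; apply: scalerDr. Qed.

Lemma odo_scaleDl A : {morph odo_scale^~ A : c d / c + d}.
Proof. by move=> c d; apply: scalerDl. Qed.

HB.instance Definition _ := GRing.Zmodule_isLmodule.Build (constants K) (odo K)
  odo_scaleA odo_scale1 odo_scaleDr odo_scaleDl.

Lemma odo_scaleAl c A B :
  odo_scale c (odo_mul A B) = odo_mul (odo_scale c A) B.
Proof. by rewrite /odo_scale odo_mulZl. Qed.

HB.instance Definition _ :=
  GRing.Lmodule_isLalgebra.Build (constants K) (odo K) odo_scaleAl.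

Lemma odo_scaleAr c A B :
  odo_scale c (odo_mul A B) = odo_mul A (odo_scale c B).
Proof.
rewrite /odo_scale /odo_mul scaler_sumr; apply: eq_bigr => i _.
rewrite scalerA mulrC -scalerA; congr (@GRing.scale K _ _ _).
elim: (nat_of_ord i) => //= j <-; rewrite odo_lmulDZ.
by have /eqP-> := constants_valP c; rewrite scale0r addr0.
Qed.

HB.instance Definition _ :=
  GRing.Lalgebra_isAlgebra.Build (constants K) (odo K) odo_scaleAr.

Section Centralizer.
Variable L : odo K.

Definition centralizer_pred : {pred odo K} := [pred A | L * A == A * L].

Lemma centralizer_closed : subalg_closed centralizer_pred.
Proof.
split=> [|c A B|A B]; rewrite !inE.
- by rewrite mulr1 mul1r.
- move=> /eqP LA /eqP LB.
  by rewrite mulrDr mulrDl -scalerAr LA LB scalerAl.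
by move=> /eqP LA /eqP LB; rewrite mulrA LA -mulrA LB mulrA.
Qed.

Record centralizer := Centralizer {
  centralizer_val :> odo K;
  centralizer_valP : centralizer_val \in centralizer_pred
}.

HB.instance Definition _ := [isSub for centralizer_val].
HB.instance Definition _ := [Choice of centralizer by <:].
HB.instance Definition _ := GRing.SubChoice_isSubAlgebra.Build
  (constants K) (odo K) centralizer_pred centralizer
  (GRing.subalg_closed_semi centralizer_closed).

End Centralizer.

End Operators.

Section Affine.
Variables (F : fieldType) (n : nat).

Local Open Scope classical_set_scope.

Definition zeros (E : set {mpoly F[n]}) : set {ffun 'I_n -> F} :=
  [set x | forall p, E p -> p.@[x] = 0].

Definition algebraic_set (X : set {ffun 'I_n -> F}) :=
  exists E : set {mpoly F[n]}, X = zeros E.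

(* Irreducibility in the Zariski topology; the empty set is not irreducible. *)
Definition irreducible_set (X : set {ffun 'I_n -> F}) :=
  X !=set0 /\
  forall Y Z, algebraic_set Y -> algebraic_set Z ->
    X `<=` Y `|` Z -> X `<=` Y \/ X `<=` Z.

Record variety := Variety {
  points :> set {ffun 'I_n -> F};
  variety_algebraic : algebraic_set points;
  variety_irreducible : irreducible_set points
}.

Definition variety_chain (X : variety) (m : nat) :=
  exists Z : nat -> variety,
    (forall i, (i < m)%N -> Z i `<` Z i.+1) /\ Z m `<=` X.

(* dim X = d: the supremum of the lengths of the chains Z_0 < ... < Z_m of
   irreducible closed subsets of X is d. *)
Definition has_dim (X : variety) (d : nat) :=
  variety_chain X d /\ forall m, variety_chain X m -> (m <= d)%N.

Definition curve (X : variety) := has_dim X 1.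

Section CoordinateRing.
Variable X : variety.

Definition vanishing_ideal : {pred {mpoly F[n]}} :=
  [pred p | `[< forall x, points X x -> p.@[x] = 0 >]].

Lemma vanishing_idealP : idealr_closed vanishing_ideal.
Proof.
split.
- by apply/asboolP => x _; rewrite meval0.
- apply/asboolP; have [[x Xx] _] := variety_irreducible X.
  by move=> /(_ x Xx)/eqP; rewrite meval1 oner_eq0.
move=> a p q /asboolP p0 /asboolP q0; apply/asboolP => x Xx.
by rewrite mevalD mevalM p0 // q0 // mulr0 addr0.
Qed.

HB.instance Definition _ :=
  isIdealr.Build {mpoly F[n]} vanishing_ideal vanishing_idealP.

Definition coordinate_ring := {ideal_quot vanishing_ideal}.

HB.instance Definition _ := GRing.ComNzRing.on coordinate_ring.

Definition coord_const (c : F) : coordinate_ring :=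
  \pi_({ideal_quot vanishing_ideal})%qT c%:MP.

Definition coord_scale (c : F) (u : coordinate_ring) : coordinate_ring :=
  coord_const c * u.

Lemma coord_scaleA c d u :
  coord_scale c (coord_scale d u) = coord_scale (c * d) u.
Proof. by rewrite /coord_scale mulrA /coord_const mpolyCM rmorphM. Qed.

Lemma coord_scale1 : left_id 1 coord_scale.
Proof. by move=> u; rewrite /coord_scale /coord_const rmorph1 mul1r. Qed.

Lemma coord_scaleDr : right_distributive coord_scale +%R.
Proof. by move=> c u v; apply: mulrDr. Qed.

Lemma coord_scaleDl u : {morph coord_scale^~ u : c d / c + d}.
Proof.
by move=> c d; rewrite /coord_scale -mulrDl /coord_const mpolyCD rmorphD.
Qed.

HB.instance Definition _ := GRing.Zmodule_isLmodule.Build F coordinate_ring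
  coord_scaleA coord_scale1 coord_scaleDr coord_scaleDl.

Lemma coord_scaleAl (c : F) (u v : coordinate_ring) :
  c *: (u * v) = c *: u * v.
Proof. exact: mulrA. Qed.

HB.instance Definition _ :=
  GRing.Lmodule_isLalgebra.Build F coordinate_ring coord_scaleAl.

Lemma coord_scaleAr (c : F) (u v : coordinate_ring) :
  c *: (u * v) = u * (c *: v).
Proof. exact: mulrCA. Qed.

HB.instance Definition _ :=
  GRing.Lalgebra_isAlgebra.Build F coordinate_ring coord_scaleAr.

End CoordinateRing.

End Affine.

Definition alg_isomorphic (R : comNzRingType) (A B : algType R) :=
  exists f : {lrmorphism A -> B}, bijective f.

(* Main.v *)
From HB Require Import structures.
Require Import Defs.
From mathcomp Require Import all_boot all_algebra.
From mathcomp Require Import boolp classical_sets.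
From mathcomp Require Import mpoly ring.

(** The centralizer Z of L is filtered by the order of operators.  Comparing the
    subleading coefficients of L A and A L determines the leading coefficient
    of A up to a constant factor, once its order is known: it solves the
    differential equation n l a' = m a l', where n, l and m, a are the orders
    and leading coefficients of L and A ([commuting_lead]).  So the graded
    pieces of Z have dimension at most one over the constants C
    ([centralizer_filtration]), and everything else is an argument about an
    algebra with such a filtration in which L is central and has prime order p
    ([prime_order_model]).

    If p divides the order of every element, an element of order kp can be
    reduced by a multiple of L^k, and Z is C[L], a polynomial ring
    ([poly_model]).  Otherwise some A has order prime to p, and the monomials
    L^i A^j realize all large orders.  A subspace V realizing all large orders
    has finite codimension, which makes any long enough sequence linearly
    dependent modulo V ([dependent_mod]).  This has two uses.

    It makes Z commutative: for every B some B h(L) with h nonzero commutes with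
    A, and h(L) is not a zero divisor, so A is central; every element then
    commutes with all L^i A^j, and is central for the same reason
    ([cofinite_commutant_central]).

    It makes Z one-dimensional: every element of Z is algebraic modulo every
    nonzero principal ideal ([algebraic_cofinite]).  As Z is generated by L and
    by elements of minimal order in the nonzero residue classes modulo p, it is
    a quotient of a polynomial ring in p variables by a prime ideal, and it
    remains to find enough points on the locus of that ideal.  Since C is
    algebraically closed, algebraicity gives each generator an eigenvalue modulo
    a proper nonzero ideal ([ideal_eigenvalue]), whence a point in the locus of
    any such ideal ([ideal_locus]).  For b nonzero some h(L) is a multiple of
    b; a point where L takes a value that is not a root of h is not a zero of
    b, which is the Nullstellensatz for this locus ([locus_separates]).  The same
    relations h(x_i) = b v show that on an irreducible subset of the zeros of b
    every coordinate is constant, so that the locus is a curve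
    ([locus_curve]). *)

Set Implicit Arguments.
Unset Strict Implicit.
Unset Printing Implicit Defensive.

Import GRing.Theory.

Local Open Scope ring_scope.

(** * Isomorphisms of algebras *)

Lemma alg_isomorphic_sym (R : comNzRingType) (A B : algType R) :
  alg_isomorphic A B -> alg_isomorphic B A.
Proof.
move=> [f [g fK gK]].
have lin_g := GRing.can2_linear fK gK.
have mon_g := GRing.can2_monoid_morphism fK gK.
pose gL := GRing.isLinear.Build R B A _ g lin_g.
pose gM := GRing.isMonoidMorphism.Build B A g mon_g.
pose gLR : {lrmorphism B -> A} := HB.pack g gL gM.
by exists gLR, f.
Qed.

Lemma alg_isomorphic_bij (R : comNzRingType) (A B : algType R) (f : A -> B) :
  linear f -> GRing.monoid_morphism f -> injective f ->
  (forall b, exists a, f a = b) -> alg_isomorphic A B.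
Proof.
move=> lin_f mon_f inj_f surj_f.
pose fL := GRing.isLinear.Build R A B _ f lin_f.
pose fM := GRing.isMonoidMorphism.Build A B f mon_f.
pose g : {lrmorphism A -> B} := HB.pack f fL fM.
have fK b : f (sval (cid (surj_f b))) = b by exact: (svalP (cid (surj_f b))).
exists g; exists (fun b => sval (cid (surj_f b))) => [a|b] /=; last exact: fK.
exact/inj_f/fK.
Qed.

(** * Points of ideals over an algebraically closed field *)

Section ClosedField.
Variables (F : fieldType) (closedF : GRing.closed_field_axiom F).

(** Nonzero polynomials split into linear factors, in the form in which this is
    used below: as an induction principle. *)
Lemma closed_poly_ind (P : {poly F} -> Prop) :
  (forall c, c != 0 -> P c%:P) ->
  (forall p a, P p -> P (p * ('X - a%:P))) ->
  forall p, p != 0 -> P p.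
Proof.
move=> PC PM p; have [m] := ubnP (size p); elim: m p => // m IHm p lt_pm p0.
have [/size_poly1P [c c0 ->]|sp1] := boolP (size p == 1)%N; first exact: PC.
have /PreClosedField.closed_rootP - /(_ closedF) [a /factor_theorem [q def_p]] := sp1.
have q0 : q != 0 by apply: contraNneq p0 => q0; rewrite def_p q0 mul0r.
rewrite def_p; apply/PM/IHm => //.
by move: lt_pm; rewrite def_p size_Mmonic ?monicXsubC // size_XsubC addn2 /= ltnS.
Qed.

End ClosedField.

Section Ideals.
Variables (F : fieldType) (closedF : GRing.closed_field_axiom F).
Variable B : comAlgType F.
Implicit Types (I J : B -> Prop) (u v w b : B).

Definition proper_ideal I :=
  [/\ I 0, forall u v, I u -> I v -> I (u + v), forall u v, I u -> I (u * v)
    & ~ I 1].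

Definition principal b v := exists w, v = b * w.

Lemma proper_principal b : (forall w, b * w != 1) -> proper_ideal (principal b).
Proof.
move=> nunit; split.
- by exists 0; rewrite mulr0.
- by move=> _ _ [u ->] [v ->]; exists (u + v); rewrite mulrDr.
- by move=> _ v [u ->]; exists (u * v); rewrite mulrA.
by move=> [w /esym/eqP]; apply/negP.
Qed.

(** Holding for all u and all nonzero b, this expresses that the algebra has
    dimension at most one: its quotients by nonzero ideals are algebraic. *)
Definition algebraic_mod b u :=
  exists2 h : {poly F}, h != 0 & principal b (horner_alg u h).

Lemma horner_alg_factor u (p : {poly F}) a :
  horner_alg u (p * ('X - a%:P)) = horner_alg u p * (u - a%:A).
Proof. by rewrite rmorphM rmorphB /= horner_algX horner_algC. Qed.

Definition adjoin I b w := exists i v, I i /\ w = i + b * v.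

(** Otherwise every u - a would be invertible modulo I. As h(u) is in I, the
    linear factors of h could be cancelled one after the other, and the
    leading coefficient of h would lie in I. *)
Lemma ideal_eigenvalue I b u :
  proper_ideal I -> I b -> algebraic_mod b u ->
  exists a : F, proper_ideal (adjoin I (u - a%:A)).
Proof.
move=> [I0 ID IM I1] Ib [h h0 hw].
have Ih : I (horner_alg u h) by case: hw => w ->; apply: IM.
suff [a Ia1] : exists a : F, ~ adjoin I (u - a%:A) 1.
  exists a; split=> //.
  - by exists 0, 0; rewrite mulr0 addr0.
  - move=> _ _ [i [v [Ii ->]]] [j [v' [Ij ->]]].
    by exists (i + j), (v + v'); split; [apply: ID | rewrite mulrDr addrACA].
  - move=> _ v' [i [v [Ii ->]]].
    by exists (i * v'), (v * v'); split; [apply: IM | rewrite mulrDl mulrA].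
apply: contrapT => /forallNP all1; apply: I1.
(* Strip the linear factors of h, keeping the value at u in I. *)
elim/(closed_poly_ind closedF): h / h0 Ih {hw} => [c c0|p a IHp]; last first.
  rewrite horner_alg_factor => Ip; apply: IHp.
  have /contrapT [i [v [Ii def1]]] := all1 a.
  rewrite -[horner_alg u p]mulr1 def1 mulrDr mulrA [_ * i]mulrC.
  by apply: ID; apply: IM.
by rewrite horner_algC => /IM - /(_ (c^-1)%:A); rewrite -in_algE -rmorphM mulfV ?rmorph1.
Qed.

End Ideals.

(** * The affine model of a one-dimensional domain *)

Section AffineModel.
Variables (F : fieldType) (closedF : GRing.closed_field_axiom F).
Variables (B : comAlgType F) (n : nat) (x : 'I_n -> B).

(** Evaluation of polynomials at the generators; its kernel is the prime ideal
    that defines the model. *)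
Definition mev : {mpoly F[n]} -> B := mmap (in_alg B) x.

HB.instance Definition _ := GRing.RMorphism.copy mev (mmap (in_alg B) x).

Lemma mevC c : mev c%:MP = c%:A.
Proof. exact: mmapC. Qed.

Lemma mevX i : mev 'X_i = x i.
Proof. by rewrite /mev mmapX mmap1U. Qed.

Hypothesis algebraicB : forall b u : B, b != 0 -> algebraic_mod b u.

(** The coordinates of the point are eigenvalues of the generators, chosen one
    at a time while the ideal grows. It stays nonzero since it contains b,
    so the next generator is still algebraic modulo it. *)
Lemma ideal_point (I : B -> Prop) b :
  proper_ideal I -> I b -> b != 0 ->
  exists (a : {ffun 'I_n -> F}) (J : B -> Prop),
    [/\ proper_ideal J, forall u, I u -> J u
      & forall i, J (x i - (a i)%:A)].
Proof.
move=> idI Ib b0.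
suff [a [J [idJ IJ Ja]]] : exists (a : 'I_n -> F) (J : B -> Prop),
    [/\ proper_ideal J, forall u, I u -> J u
      & forall i, i \in enum 'I_n -> J (x i - (a i)%:A)].
  exists [ffun i => a i], J; split=> // i.
  by rewrite ffunE; apply: Ja; rewrite mem_enum.
elim: (enum 'I_n) => [|i s [a [J [idJ IJ Ja]]]]; first by exists (fun=> 0), I.
have [c idJ'] := ideal_eigenvalue closedF idJ (IJ b Ib)
  (algebraicB (x i) b0).
exists (fun j => if j == i then c else a j), (adjoin J (x i - c%:A)); split=> //.
  by move=> u /IJ Ju; exists u, 0; rewrite mulr0 addr0.
case: idJ => J0 _ _ _ j; rewrite inE; case: eqP => [-> _ | _ /Ja Jj] /=.
  by exists 0, 1; rewrite add0r mulr1.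
by exists (x j - (a j)%:A), 0; rewrite mulr0 addr0.
Qed.

(** The ideal J plays the part of the maximal ideal of the point a, so reduction
    modulo J is evaluation at a. *)
Lemma mev_mod (J : B -> Prop) (a : 'I_n -> F) :
  proper_ideal J -> (forall i, J (x i - (a i)%:A)) ->
  forall p, J (mev p - p.@[a]%:A).
Proof.
move=> [J0 JD JM _] Ja.
pose P p := J (mev p - p.@[a]%:A).
have PC c : P c%:MP by rewrite /P mevC mevalC subrr.
have PD p q : P p -> P q -> P (p + q).
  by rewrite /P rmorphD mevalD scalerDl opprD addrACA; apply: JD.
have PM p q : P p -> P q -> P (p * q).
  move=> Pp Pq; rewrite /P rmorphM mevalM /=.
  have -> : mev p * mev q - (p.@[a] * q.@[a])%:A =
      (mev p - p.@[a]%:A) * mev q + (mev q - q.@[a]%:A) * p.@[a]%:A.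
    by rewrite -!in_algE (rmorphM (in_alg B)); ring.
  by apply: JD; apply: JM.
have PX i : P 'X_i by rewrite /P mevX mevalXU.
move=> p; elim/mpolyind: p => [|c m p _ _ Pp]; first exact: (PC 0).
apply: (PD) => //; rewrite -mul_mpolyC; apply: (PM) => //.
rewrite mpolyXE_id; elim/big_ind: _ => // [|i _]; first exact: (PC 1).
by elim: (m _) => [|k IHk]; [exact: (PC 1) | rewrite exprS; apply: PM].
Qed.

Local Open Scope classical_set_scope.

Definition locus : set {ffun 'I_n -> F} := zeros [set p | mev p = 0].

Lemma ideal_locus (I : B -> Prop) b :
  proper_ideal I -> I b -> b != 0 ->
  exists2 a, locus a & exists2 J, proper_ideal J &
    (forall u, I u -> J u) /\ forall p, J (mev p - p.@[a]%:A).
Proof.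
move=> idI Ib b0; have [a [J [idJ IJ Ja]]] := ideal_point idI Ib b0.
have Jp := mev_mod idJ Ja; exists a; last by exists J.
move=> p /= p0; move: (Jp p); rewrite p0 sub0r => JNp.
have [pa0|] := eqVneq p.@[a] 0; first by [].
case: idJ => _ _ JM J1 pa0; case: J1.
move: JNp => /JM - /(_ (- p.@[a]^-1)%:A).
by rewrite scaleNr mulrNN -!in_algE -rmorphM mulfV ?rmorph1.
Qed.

Variable t : B.
Hypothesis nonunit_t : forall c v, (t - c%:A) * v != 1.

Lemma nonconst_t c : t - c%:A != 0.
Proof.
apply/eqP => tc; move: (nonunit_t (c - 1) 1).
by rewrite scalerBl opprB addrCA tc addr0 scale1r mulr1 eqxx.
Qed.

(** The fibre of t over c: the ideal generated by t - c is proper because t - c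
    is not invertible. *)
Lemma fiber_point c : exists2 a, locus a & exists2 J, proper_ideal J &
  J (t - c%:A) /\ forall p, J (mev p - p.@[a]%:A).
Proof.
have It : principal (t - c%:A) (t - c%:A) by exists 1; rewrite mulr1.
have [a Xa [J idJ [IJ Jp]]] :=
  ideal_locus (proper_principal (nonunit_t c)) It (nonconst_t c).
by exists a => //; exists J; rewrite //; split; [apply: IJ|].
Qed.

(** The Nullstellensatz for the locus. Write b for the value of p. Some h(t) is
    a multiple of b; at a point where t takes a value c that is not a root
    of h, the ideal J of the point cannot contain b, for it would contain
    h(t), hence the nonzero constant h(c). *)
Lemma locus_separates p : mev p != 0 -> exists2 a, locus a & p.@[a] != 0.
Proof.
move=> p0; have [h h0 [v htv]] := algebraicB t p0.
have /(PreClosedField.closed_nonrootP closedF) [c hc] := h0.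
have [a Xa [J [J0 JD JM J1] [Jt Jp]]] := fiber_point c.
exists a => //; apply/negP => /eqP pa0; apply: J1.
have Jh : J (horner_alg t h).
  by rewrite htv; apply: JM; have := Jp p; rewrite pa0 scale0r subr0.
have [q def_h] : exists q, h - h.[c]%:P = q * ('X - c%:P).
  by apply/factor_theorem; rewrite /root !hornerE subrr.
have def_hc : h.[c]%:A = horner_alg t h + (t - c%:A) * (- horner_alg t q).
  rewrite mulrN mulrC -horner_alg_factor -def_h rmorphB /= horner_algC.
  by rewrite opprB addrCA subrr addr0.
have : J h.[c]%:A by rewrite def_hc; apply: JD; [|apply: JM].
by move=> /JM - /(_ (h.[c]^-1)%:A); rewrite -in_algE -rmorphM mulfV ?rmorph1.
Qed.

Lemma fiber_value q c : mev q = t -> exists2 a, locus a & q.@[a] = c.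
Proof.
move=> qt; have [a Xa [J [J0 JD JM J1] [Jt Jp]]] := fiber_point c.
exists a => //; apply/eqP; rewrite -subr_eq0; apply/negP => /negP qac; apply: J1.
have def_d : (q.@[a] - c)%:A = (t - c%:A) + (mev q - q.@[a]%:A) * -1 :> B.
  by rewrite qt mulrN1 opprB addrAC addrCA addrC subrr addr0 scalerBl addrC.
have : J (q.@[a] - c)%:A by rewrite def_d; apply: JD => //; apply: JM.
by move=> /JM - /(_ ((q.@[a] - c)^-1)%:A); rewrite -in_algE -rmorphM mulfV ?rmorph1.
Qed.

Hypothesis domainB : forall u v : B, u * v = 0 -> u = 0 \/ v = 0.
Hypothesis mev_surj : forall b, exists p, mev p = b.

Lemma mev_eq0 p : mev p = 0 <-> forall a, locus a -> p.@[a] = 0.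
Proof.
split=> [p0 a Xa | p0]; first exact: Xa.
by apply/eqP; apply: contraT => /locus_separates [a /p0 -> /eqP].
Qed.

Lemma locus_irreducible : irreducible_set locus.
Proof.
split.
  have [a Xa _] := fiber_point 0.
  by exists a.
move=> Y Z [EY ->] [EZ ->] XYZ; apply: contrapT => /not_orP [XY XZ].
have nsub E : ~ locus `<=` zeros E -> exists p, E p /\ mev p <> 0.
  move=> /existsNP [a /not_implyP [Xa /existsNP [p /not_implyP [Ep pa]]]].
  by exists p; split=> // /mev_eq0 /(_ a Xa).
have [[p [EYp p0]] [q [EZq q0]]] := (nsub _ XY, nsub _ XZ).
suff /domainB [] : mev p * mev q = 0 by [].
rewrite -rmorphM; apply/mev_eq0 => a /XYZ [] Ea; rewrite mevalM.
  by rewrite (Ea p) ?mul0r.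
by rewrite (Ea q) ?mulr0.
Qed.

Lemma locus_algebraic : algebraic_set locus.
Proof. by exists [set p | mev p = 0]. Qed.

Definition locus_variety := Variety locus_algebraic locus_irreducible.

Lemma point_algebraic (a : {ffun 'I_n -> F}) : algebraic_set [set a].
Proof.
exists [set p | p.@[a] = 0]; apply/seteqP; split=> [_ -> p //|b ab].
apply/ffunP => i; apply/eqP; rewrite -subr_eq0.
have := ab ('X_i - (a i)%:MP); rewrite /= !mevalB !mevalXU !mevalC => -> //.
by rewrite subrr.
Qed.

Lemma point_irreducible (a : {ffun 'I_n -> F}) : irreducible_set [set a].
Proof.
split=> [|Y Z _ _ /(_ a erefl) [Ya|Za]]; first by exists a.
  by left=> _ ->.
by right=> _ ->.
Qed.

Definition point_variety a :=
  Variety (point_algebraic a) (point_irreducible a).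

Lemma meval_horner_alg (p : {mpoly F[n]}) (h : {poly F}) a :
  (horner_alg p h).@[a] = h.[p.@[a]].
Proof.
elim/poly_ind: h => [|r d IHr]; first by rewrite rmorph0 meval0 horner0.
rewrite rmorphD rmorphM /= horner_algX horner_algC mevalD mevalM IHr.
by rewrite mevalZ meval1 mulr1 hornerD hornerM hornerX hornerC.
Qed.

Lemma mev_horner_alg (p : {mpoly F[n]}) (h : {poly F}) :
  mev (horner_alg p h) = horner_alg (mev p) h.
Proof.
elim/poly_ind: h => [|r d IHr]; first by rewrite !rmorph0.
rewrite !rmorphD !rmorphM /= !horner_algX !horner_algC IHr.
by rewrite -mul_mpolyC mulr1 mevC.
Qed.

(** The composite h(p) splits into factors p - c, and an irreducible set on
    which a product vanishes lies in the zeros of one of its factors. *)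
Lemma irreducible_root (Y : variety F n) p (h : {poly F}) :
  h != 0 -> (forall a, points Y a -> h.[p.@[a]] = 0) ->
  exists c, forall a, points Y a -> p.@[a] = c.
Proof.
have [[y Yy] irrY] := variety_irreducible Y.
move=> h0; elim/(closed_poly_ind closedF): h / h0 => [c c0|h c IHh] hY.
  by move: (hY y Yy) c0; rewrite hornerC => ->; rewrite eqxx.
have [] : points Y `<=` zeros [set horner_alg p h] \/
    points Y `<=` zeros [set horner_alg p ('X - c%:P)].
- apply: irrY; [by eexists | by eexists |].
  move=> a /hY/eqP; rewrite hornerM mulf_eq0 => /orP [] /eqP ha; [left|right].
    by move=> _ ->; rewrite meval_horner_alg.
  by move=> _ ->; rewrite meval_horner_alg.
- by move=> Yh; apply: IHh => a /Yh /(_ _ erefl); rewrite meval_horner_alg.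
move=> Yc; exists c => a /Yc /(_ _ erefl) /eqP.
by rewrite meval_horner_alg hornerXsubC subr_eq0 => /eqP.
Qed.

(** A proper closed subset lies in the zeros of some p with nonzero value b in
    the algebra. Each generator satisfies a relation h(x_i) = b v, so h(x_i)
    vanishes on the subset, and irreducibility makes the coordinate x_i
    constant. *)
Lemma proper_subset_point (Y : variety F n) :
  Y `<` locus -> exists a, Y `<=` [set a].
Proof.
move=> [YX XY]; have [[y Yy] _] := variety_irreducible Y.
have [E defY] := variety_algebraic Y.
have [p [Yp p0]] : exists p, (forall a, points Y a -> p.@[a] = 0) /\ mev p != 0.
  move: XY => /existsNP [a /not_implyP [Xa]]; rewrite defY.
  move=> /existsNP [p /not_implyP [Ep pa]].
  exists p; split=> [z Yz|]; first exact: Yz.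
  by apply/eqP => /mev_eq0 /(_ a Xa).
exists y => a Ya; apply/ffunP => i.
have [h h0 [v hv]] := algebraicB (x i) p0; have [q def_v] := mev_surj v.
have [c Yc] : exists c, forall a, points Y a -> ('X_i : {mpoly F[n]}).@[a] = c.
  apply: (irreducible_root h0) => z Yz.
  have /mev_eq0/(_ z (YX z Yz))/eqP : mev (horner_alg 'X_i h - p * q) = 0.
    by rewrite rmorphB rmorphM /= mev_horner_alg mevX hv def_v subrr.
  by rewrite mevalB mevalM meval_horner_alg (Yp z Yz) mul0r subr0 => /eqP.
have := Yc a Ya; rewrite -(Yc y Yy) !mevalXU; exact.
Qed.

(** The locus has a second point since t takes both values 0 and 1 on it. *)
Lemma point_locus a : locus a -> [set a] `<` locus.
Proof.
move=> Xa; split=> [_ -> //|Xsub].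
have [q qt] := mev_surj t.
have [b /Xsub -> qa0] := fiber_value 0 qt.
have [c /Xsub -> qa1] := fiber_value 1 qt.
by move: (oner_neq0 F); rewrite -qa1 qa0 eqxx.
Qed.

(** In a chain Z_0 < Z_1 < Z_2 the set Z_1 is proper in the locus, so it lies in
    a point and leaves no room for Z_0. *)
Lemma locus_curve : curve locus_variety.
Proof.
split.
  have [[a Xa] _] := locus_irreducible.
  exists (fun i => if i is 0%N then point_variety a else locus_variety).
  by split=> // [[]] // _; apply: point_locus.
case=> [|[|m]] // [Z [Zlt Zm]].
have Zsub i j : (i <= j <= m.+2)%N -> Z i `<=` Z j.
  elim: j => [|j IHj]; first by rewrite leqn0 andbT => /eqP ->.
  rewrite leq_eqVlt andbC => /andP [jm /orP [/eqP -> //|ij]].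
  apply: subset_trans (IHj _) (Zlt j jm).1.
  by rewrite -ltnS ij ltnW.
have [a Z1a] : exists a, Z 1%N `<=` [set a].
  apply: proper_subset_point; split.
    by apply: subset_trans Zm; apply: Zsub; rewrite leqnn.
  move=> XZ1; apply: (Zlt 1%N isT).2.
  by apply: subset_trans XZ1; apply: subset_trans Zm; apply: Zsub; rewrite leqnn.
have [[z Z0z] _] := variety_irreducible (Z 0%N).
have [Z01 Z10] := Zlt 0%N isT.
by case: Z10 => w /Z1a ->; rewrite -(Z1a z (Z01 z Z0z)).
Qed.

Lemma mev_coord p q :
  (\pi_(coordinate_ring locus_variety)%qT p =
   \pi_(coordinate_ring locus_variety)%qT q) <-> mev p = mev q.
Proof.
transitivity (p - q \in vanishing_ideal locus_variety).
  by rewrite Quotient.idealrBE; split=> [/eqP|/eqP].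
transitivity (mev (p - q) = 0); last first.
  by rewrite rmorphB /=; split=> [/eqP|->]; rewrite ?subrr // subr_eq0 => /eqP.
by rewrite mev_eq0; split=> [/asboolP|h]; last apply/asboolP.
Qed.

(** The coordinate ring is the polynomial ring modulo the kernel of evaluation,
    so the value of a representative does not depend on its choice (see
    [mev_coord]). *)
Definition coord_mev (u : coordinate_ring locus_variety) : B := mev (repr u).

Lemma coord_mevE p : coord_mev (\pi_(coordinate_ring locus_variety)%qT p) = mev p.
Proof. by apply/mev_coord; rewrite reprK. Qed.

(** By the Nullstellensatz the vanishing ideal of the locus is the kernel of
    evaluation, so evaluation induces the isomorphism. *)
Lemma locus_model : exists X : variety F n,
  curve X /\ alg_isomorphic B (coordinate_ring X).
Proof.
exists locus_variety; split; first exact: locus_curve.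
pose quo (p : {mpoly F[n]}) : coordinate_ring locus_variety :=
  \pi_(coordinate_ring locus_variety)%qT p.
have quoP u : exists p, u = quo p by exists (repr u); rewrite /quo reprK.
have coordE p : coord_mev (quo p) = mev p by apply: coord_mevE.
apply: alg_isomorphic_sym; apply: (@alg_isomorphic_bij _ _ _ coord_mev).
- move=> c u v; have [[p ->] [q ->]] := (quoP u, quoP v).
  have -> : c *: quo p + quo q = quo (c%:MP * p + q).
    by rewrite /quo rmorphD rmorphM.
  by rewrite !coordE rmorphD rmorphM /= mevC mulr_algl.
- split=> [|u v].
    by have -> : 1 = quo 1; [rewrite /quo rmorph1 | rewrite coordE rmorph1].
  have [[p ->] [q ->]] := (quoP u, quoP v).
  have -> : quo p * quo q = quo (p * q) by rewrite /quo rmorphM.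
  by rewrite !coordE rmorphM.
- move=> u v; have [[p ->] [q ->]] := (quoP u, quoP v).
  by rewrite !coordE => /mev_coord.
by move=> b; have [p <-] := mev_surj b; exists (quo p).
Qed.

End AffineModel.

(** * Algebras filtered with one-dimensional graded pieces *)

(** By the Chinese remainder theorem some multiple y o of o is congruent to m
    modulo p, and y can be reduced modulo p, so that y o is at most p o. *)
Lemma coprime_sum_representable p o m : coprime p o -> (0 < p)%N -> (p * o <= m)%N ->
  exists i j, m = (i * p + j * o)%N.
Proof.
move=> cop p0 le_m; pose z := chinese p o m 0.
have /dvdnP [y def_z] : (o %| z)%N by rewrite /dvdn chinese_modr // mod0n.
have zm : z = m %[mod p] by apply: chinese_modl.
pose j := (y %% p)%N; have le_j : (j * o <= m)%N.
  by apply: leq_trans le_m; rewrite leq_mul2r ltnW ?ltn_mod ?orbT.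
have /dvdnP [i def_i] : (p %| m - j * o)%N.
  by rewrite -eqn_mod_dvd // -zm def_z modnMml.
by exists i, j; rewrite -def_i subnK.
Qed.

Section SizeFiltration.
Variables (F : fieldType) (A : algType F) (sz : A -> nat).
Implicit Types (u v w : A) (c : F).

(** Here [sz u] is one more than the order of u, and zero for u = 0, as for the
    size of a polynomial. The last clause says that the graded pieces have
    dimension at most one. *)
Definition size_filtration :=
  [/\ forall u, (sz u == 0)%N = (u == 0),
      forall u v, (sz (u + v) <= maxn (sz u) (sz v))%N,
      forall u v, u != 0 -> v != 0 -> (sz (u * v)).+1 = (sz u + sz v)%N
    & forall u v, u != 0 -> sz u = sz v -> exists c, (sz (u - c *: v)%R < sz u)%N].

Hypothesis filt : size_filtration.

Lemma sz0E u : (sz u == 0)%N = (u == 0). Proof. by case: filt. Qed.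

Lemma sz_gt0 u : (0 < sz u)%N = (u != 0).
Proof. by rewrite lt0n sz0E. Qed.

Lemma sz0 : sz 0 = 0%N. Proof. by apply/eqP; rewrite sz0E. Qed.

Lemma szD u v : (sz (u + v) <= maxn (sz u) (sz v))%N. Proof. by case: filt. Qed.

Lemma szM u v : u != 0 -> v != 0 -> (sz (u * v)).+1 = (sz u + sz v)%N.
Proof. by case: filt => ? ? + _; apply. Qed.

Lemma sz_cancel u v :
  u != 0 -> sz u = sz v -> exists c, (sz (u - c *: v) < sz u)%N.
Proof. by case: filt => ? ? ? +; apply. Qed.

Lemma filtM_neq0 u v : u != 0 -> v != 0 -> u * v != 0.
Proof.
move=> u0 v0; rewrite -sz_gt0 -ltnS szM // (@leq_add 1 1) ?sz_gt0 //.
Qed.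

Lemma filt_domain u v : u * v = 0 -> u = 0 \/ v = 0.
Proof.
move=> uv0; have [|u0] := eqVneq u 0; first by left.
have [|v0] := eqVneq v 0; first by right.
by move: (filtM_neq0 u0 v0); rewrite uv0 eqxx.
Qed.

Lemma sz1 : sz 1 = 1%N.
Proof.
have := szM (oner_neq0 A) (oner_neq0 A); rewrite mulr1 => h.
by apply: (@addnI (sz 1)); rewrite -h addn1.
Qed.

(** The sizes of a nonzero constant and of its inverse add up to 2. *)
Lemma sz_alg c : (sz c%:A <= 1)%N.
Proof.
have [->|c0] := eqVneq c 0; first by rewrite scale0r sz0.
have cV : c%:A * c^-1%:A = 1 :> A.
  by rewrite -!in_algE -rmorphM mulfV ?rmorph1.
have uv0 : c%:A != 0 :> A /\ c^-1%:A != 0 :> A.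
  split; apply: contraNneq (oner_neq0 A) => z0.
    by rewrite -cV z0 mul0r.
  by rewrite -cV z0 mulr0.
have := szM uv0.1 uv0.2; rewrite cV sz1.
have : (0 < sz c^-1%:A)%N by rewrite sz_gt0 uv0.2.
by case: (sz c^-1%:A) => // k _; rewrite addnS => -[->]; rewrite leq_addr.
Qed.

Lemma szZ c u : (sz (c *: u) <= sz u)%N.
Proof.
have [->|cu0] := eqVneq (c *: u) 0; first by rewrite sz0.
have [u0 c0] : u != 0 /\ c%:A != 0 :> A.
  split; apply: contraNneq cu0 => z0; first by rewrite z0 scaler0.
  by rewrite -[u]mul1r scalerAl z0 mul0r.
have := szM c0 u0; rewrite mulr_algl -ltnS => ->.
by rewrite -add1n leq_add2r sz_alg.
Qed.

Lemma szN u : (sz (- u) <= sz u)%N.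
Proof. by rewrite -scaleN1r szZ. Qed.

Lemma szX u k : u != 0 -> sz (u ^+ k) = (k * (sz u).-1).+1 /\ u ^+ k != 0.
Proof.
move=> u0; elim: k => [|k [IHs IH0]]; first by rewrite expr0 sz1 oner_neq0.
rewrite exprS filtM_neq0 //; split=> //.
apply: (@addnI 1); rewrite !add1n szM // IHs -{1}(prednK (_ : 0 < sz u)%N) ?sz_gt0 //.
by rewrite addSn addnS mulSn.
Qed.

Lemma transcendental_neq0 u (h : {poly F}) :
  (1 < sz u)%N -> h != 0 -> horner_alg u h != 0.
Proof.
move=> u1; have u0 : u != 0 by rewrite -sz_gt0 ltnW.
elim/poly_ind: h => [|q c IHq]; first by rewrite eqxx.
rewrite rmorphD rmorphM /= horner_algX horner_algC.
have [->|q0] := eqVneq q 0.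
  rewrite !(mul0r, add0r, rmorph0) polyC_eq0 => c0.
  by apply: contraNneq (oner_neq0 A) => z0; rewrite -(scale1r 1) -(mulVf c0) -scalerA z0 scaler0.
move=> _; have hq0 := IHq q0; apply/eqP => /eqP; rewrite addr_eq0 => /eqP hc.
have := szM hq0 u0; rewrite hc => e.
have : (1 + 2 <= sz (horner_alg u q) + sz u)%N by rewrite leq_add // sz_gt0.
by rewrite -e ltnS leqNgt ltnS (leq_trans (szN _) (sz_alg c)).
Qed.

Definition subspace (V : A -> Prop) :=
  [/\ V 0, forall u v, V u -> V v -> V (u + v) & forall c u, V u -> V (c *: u)].

(** All orders from M on occur in V; recall that order m is size m + 1. *)
Definition cofinite_orders (V : A -> Prop) M :=
  forall m, (M <= m)%N -> exists v, V v /\ sz v = m.+1.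

Lemma reduce_mod V M u : subspace V -> cofinite_orders V M ->
  exists v, V v /\ (sz (u - v)%R <= M)%N.
Proof.
move=> [V0 VD VZ] fullV; have [m] := ubnP (sz u).
elim: m u => // m IHm u; rewrite ltnS => le_um.
have [le_uM|lt_Mu] := leqP (sz u) M; first by exists 0; rewrite subr0.
have u0 : u != 0 by rewrite -sz_gt0 (leq_ltn_trans _ lt_Mu).
have [|v [Vv sz_v]] := fullV (sz u).-1; first by rewrite -ltnS prednK ?sz_gt0.
rewrite prednK ?sz_gt0 // in sz_v.
have [c lt_c] := sz_cancel u0 (esym sz_v).
have [w [Vw le_w]] := IHm _ (leq_trans lt_c le_um).
exists (w + c *: v); split; first by apply: VD => //; apply: VZ.
by rewrite [w + _]addrC opprD addrA.
Qed.

(** One element of each order that occurs spans the algebra, by cancelling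
    leading terms; the default 0 stands for the orders that do not occur. *)
Lemma low_basis : exists e : nat -> A, forall M u, (sz u <= M)%N ->
  exists c : nat -> F, u = \sum_(i < M) c i *: e i.
Proof.
have /choice [e eP] : forall i : nat, exists v,
    forall u, sz u = i.+1 -> sz v = i.+1.
  move=> i; have [[v sz_v]|no_v] := pselect (exists v, sz v = i.+1).
    by exists v.
  by exists 0 => u sz_u; case: no_v; exists u.
exists e; elim=> [|M IHM] u.
  by rewrite leqn0 sz0E => /eqP ->; exists (fun=> 0); rewrite big_ord0.
rewrite leq_eqVlt ltnS => /orP [/eqP sz_u|/IHM [c ->]]; last first.
  exists (fun i => if (i < M)%N then c i else 0).
  rewrite big_ord_recr /= ltnn scale0r addr0.
  by apply: eq_bigr => i _; rewrite ltn_ord.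
have u0 : u != 0 by rewrite -sz_gt0 sz_u.
have [d] := sz_cancel u0 (etrans sz_u (esym (eP M u sz_u))).
rewrite sz_u ltnS => /IHM [c def_c].
exists (fun i => if (i < M)%N then c i else d).
rewrite big_ord_recr /= ltnn; apply/eqP; rewrite -subr_eq def_c; apply/eqP.
by apply: eq_bigr => i _; rewrite ltn_ord.
Qed.

(** Modulo V each of w_0, ..., w_M can be replaced by an element of order less
    than M, and these elements lie in a space of dimension at most M. The
    coefficients of the dependency are packed in a polynomial h since the
    w_k will be multiples of powers of a single element. *)
Lemma dependent_mod V M (w : nat -> A) : subspace V -> cofinite_orders V M ->
  exists2 h : {poly F}, h != 0 & V (\sum_(k < size h) h`_k *: w k).
Proof.
move=> subV fullV; have [e eP] := low_basis.
have /choice [v vP] := fun k => reduce_mod (w k) subV fullV.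
have /choice [c cP] := fun k => eP _ _ (vP k).2.
pose C := \matrix_(k < M.+1, i < M) c k i.
have [z zC z0] : exists2 z : 'rV_M.+1, z *m C = 0 & z != 0.
  have : kermx C != 0.
    by rewrite kermx_eq0 /row_free neq_ltn ltnS rank_leq_col.
  by move=> /rowV0Pn [z /sub_kermxP zC z0]; exists z.
have sub0 (h : {poly F}) : (size h <= M.+1)%N ->
    \sum_(k < size h) h`_k *: w k = \sum_(k < M.+1) h`_k *: w k.
  move=> le_h; rewrite (big_ord_widen M.+1 (fun k => h`_k *: w k) le_h) big_mkcond.
  apply: eq_bigr => i _; case: ltnP => // /(nth_default _) ->.
  by rewrite scale0r.
exists (rVpoly z); first by rewrite -(inj_eq (can_inj rVpolyK)) linear0 in z0 *.
rewrite sub0 ?size_poly //.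
have -> : \sum_(k < M.+1) (rVpoly z)`_k *: w k = \sum_(k < M.+1) z 0 k *: v k.
  apply/eqP; rewrite -subr_eq0 -sumrB; apply/eqP.
  transitivity (\sum_(k < M.+1) \sum_(i < M) (z 0 k * C k i) *: e i).
    apply: eq_bigr => k _; rewrite coef_rVpoly_ord -scalerBr cP scaler_sumr.
    by apply: eq_bigr => i _; rewrite scalerA mxE.
  rewrite exchange_big big1 //= => i _; rewrite -scaler_suml.
  by have := congr1 (fun X : 'rV_M => X 0 i) zC; rewrite !mxE => ->; rewrite scale0r.
case: subV => V0 VD VZ.
by elim/big_ind: _ => // k _; apply: VZ; case: (vP k).
Qed.

Lemma horner_alg_coef u (h : {poly F}) :
  horner_alg u h = \sum_(k < size h) h`_k *: u ^+ k.
Proof.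
rewrite -{1}(coefK h) poly_def rmorph_sum; apply: eq_bigr => k _ /=.
by rewrite -mul_polyC rmorphM rmorphXn /= horner_algX horner_algC mulr_algl.
Qed.

Lemma multiples_cofinite b M :
  b != 0 -> cofinite_orders (fun=> True) M ->
  cofinite_orders (fun v => exists w, v = b * w) (M + sz b).
Proof.
move=> b0 fullA m le_m; have b_gt0 : (0 < sz b)%N by rewrite sz_gt0.
have le_bm : (sz b <= m.+1)%N by rewrite ltnW // ltnS (leq_trans _ le_m) ?leq_addl.
have [|w [_ sz_w]] := fullA (m.+1 - sz b)%N.
  by rewrite leq_subRL // addnC (leq_trans le_m).
exists (b * w); split; first by exists w.
have w0 : w != 0 by rewrite -sz_gt0 sz_w.
by apply: succn_inj; rewrite szM // sz_w addnS subnKC.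
Qed.

(** Apply [dependent_mod] to the powers of u and to the ideal generated by b. *)
Lemma algebraic_cofinite M b u :
  b != 0 -> cofinite_orders (fun=> True) M ->
  exists2 h : {poly F}, h != 0 & exists w, horner_alg u h = b * w.
Proof.
move=> b0 /(multiples_cofinite b0) fullV.
have [|h h0 hV] := dependent_mod (fun k => u ^+ k) _ fullV.
  split=> [|_ _ [v ->] [w ->]|c _ [v ->]]; first by exists 0; rewrite mulr0.
    by exists (v + w); rewrite mulrDr.
  by exists (c *: v); rewrite scalerAr.
by exists h; rewrite ?horner_alg_coef.
Qed.

Definition commutant a u := u * a = a * u.

Lemma commutant_subspace a : subspace (commutant a).
Proof.
rewrite /commutant; split=> [|u v ua va|c u ua]; first by rewrite mulr0 mul0r.
  by rewrite mulrDl mulrDr ua va.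
by rewrite -scalerAl -scalerAr ua.
Qed.

Lemma commutant_horner a u (h : {poly F}) :
  commutant a u -> commutant a (horner_alg u h).
Proof.
have [C0 CD CZ] := commutant_subspace a; move=> ua; rewrite horner_alg_coef.
elim/big_ind: _ => // k _; apply: CZ; exact/commr_sym/commrX/commr_sym.
Qed.

(** By [dependent_mod] applied to the elements u L^k, some u h(L) commutes with
    a. So does h(L), hence (u a - a u) h(L) = 0, and h(L) is nonzero. *)
Lemma cofinite_commutant_central L a M :
  (1 < sz L)%N -> commutant a L -> cofinite_orders (commutant a) M ->
  forall u, commutant a u.
Proof.
move=> L1 aL fullC u.
have [h h0] := dependent_mod (fun k => u * L ^+ k) (commutant_subspace a) fullC.
have -> : \sum_(k < size h) h`_k *: (u * L ^+ k) = u * horner_alg L h.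
  by rewrite horner_alg_coef mulr_sumr; apply: eq_bigr => k _; rewrite scalerAr.
have hL := commutant_horner h aL; rewrite /commutant -mulrA hL => eq_uh.
have : (u * a - a * u) * horner_alg L h = 0 by rewrite mulrBl -!mulrA eq_uh subrr.
case/filt_domain => [/eqP|hL0]; first by rewrite subr_eq0 => /eqP.
by have := transcendental_neq0 L1 h0; rewrite hL0 eqxx.
Qed.

End SizeFiltration.

(** * A central element of prime order *)

Section PrimeOrder.
Variables (F : fieldType) (closedF : GRing.closed_field_axiom F).
Variables (A : algType F) (sz : A -> nat) (filt : size_filtration sz).
Variables (p : nat) (p_prime : prime p).
Variables (L : A) (sz_L : sz L = p.+1) (L_central : forall u, L * u = u * L).

Let p_gt0 : (0 < p)%N := prime_gt0 p_prime.

Lemma L_neq0 : L != 0.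
Proof. by rewrite -(sz_gt0 filt) sz_L. Qed.

Lemma sz_powL k : sz (L ^+ k) = (k * p).+1 /\ L ^+ k != 0.
Proof. by have := szX filt k L_neq0; rewrite sz_L. Qed.

Lemma sz_mul_powL k u : u != 0 -> sz (L ^+ k * u) = (k * p + sz u)%N.
Proof.
move=> u0; have [sz_k k0] := sz_powL k.
by apply: succn_inj; rewrite (szM filt) // sz_k addSn.
Qed.

Lemma sz_L_gt1 : (1 < sz L)%N.
Proof. by rewrite sz_L ltnS. Qed.

(** The powers of L realize all orders that occur, so every element reduces to 0
    by subtracting multiples of powers of L. *)
Lemma poly_model :
  (forall u, u != 0 -> (p %| (sz u).-1)%N) -> alg_isomorphic A {poly F}.
Proof.
move=> p_dvd; apply: alg_isomorphic_sym.
apply: (@alg_isomorphic_bij _ _ _ (horner_alg L)).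
- by move=> c f g; rewrite rmorphD -mul_polyC rmorphM /= horner_algC mulr_algl.
- by split; [apply: rmorph1 | apply: rmorphM].
- move=> f g eq_fg; apply/eqP; rewrite -subr_eq0; apply: contraTT isT => fg0.
  by have := transcendental_neq0 filt sz_L_gt1 fg0; rewrite rmorphB /= eq_fg subrr eqxx.
move=> u; have [m] := ubnP (sz u); elim: m u => // m IHm u; rewrite ltnS => le_um.
have [->|u0] := eqVneq u 0; first by exists 0; rewrite rmorph0.
have /dvdnP [k sz_u] := p_dvd u u0.
have eq_sz : sz u = sz (L ^+ k).
  by rewrite (sz_powL k).1 -sz_u prednK ?sz_gt0.
have [c lt_c] := sz_cancel filt u0 eq_sz.
have [f def_f] := IHm _ (leq_trans lt_c le_um).
exists (f + c *: 'X^k).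
rewrite rmorphD -mul_polyC rmorphM /= rmorphXn /= horner_algX horner_algC.
by rewrite mulr_algl def_f subrK.
Qed.

Section Coprime.
Variables (a : A) (a0 : a != 0) (cop_a : coprime p (sz a).-1).

Lemma monomials_cofinite (V : A -> Prop) :
  (forall i j, V (L ^+ i * a ^+ j)) ->
  cofinite_orders sz V (p * (sz a).-1).
Proof.
move=> Vmon m /(coprime_sum_representable cop_a p_gt0) [i [j ->]].
exists (L ^+ i * a ^+ j); split=> //; have [sz_j j0] := szX filt j a0.
by rewrite sz_mul_powL // sz_j addnS.
Qed.

Lemma full_cofinite : cofinite_orders sz (fun=> True) (p * (sz a).-1).
Proof. exact: monomials_cofinite. Qed.

(** If b commutes with a, the commutant of b contains all L^i a^j, hence
    realizes all large orders. *)
Lemma commutant_of_gen b : a * b = b * a -> forall u, commutant b u.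
Proof.
move=> ab; apply: (cofinite_commutant_central filt sz_L_gt1 (L_central b)).
apply: monomials_cofinite => i j.
by apply/commr_sym/commrM; apply: commrX; [apply/commr_sym/L_central|].
Qed.

(** First a is central, since a commutes with itself; then every v commutes with
    a, hence is central too. *)
Lemma filt_commutative (u v : A) : u * v = v * u.
Proof. by apply: commutant_of_gen; symmetry; apply: commutant_of_gen. Qed.

Lemma minimal_rep : exists y : 'I_p -> A, forall r : 'I_p,
  [/\ y r != 0, ((sz (y r)).-1 %% p)%N = r
    & forall u, u != 0 -> ((sz u).-1 %% p)%N = r -> (sz (y r) <= sz u)%N].
Proof.
suff /choice [y yP] : forall r : 'I_p, exists y, [/\ y != 0,
    ((sz y).-1 %% p)%N = r
    & forall u, u != 0 -> ((sz u).-1 %% p)%N = r -> (sz y <= sz u)%N].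
  by exists y.
move=> r; set M := (p * (sz a).-1)%N.
pose P m := `[< exists u, [/\ u != 0, ((sz u).-1 %% p)%N = r & sz u = m] >].
have exP : exists m, P m.
  have [|u [_ sz_u]] := full_cofinite (m := M * p + r).
    by rewrite (leq_trans _ (leq_addr _ _)) ?leq_pmulr.
  exists (sz u); apply/asboolP; exists u; rewrite -(sz_gt0 filt) sz_u /=.
  by rewrite modnMDl modn_small.
case: (ex_minnP exP) => m /asboolP [y [y0 yr sz_y]] min_m.
exists y; split=> // u u0 ur; rewrite sz_y; apply: min_m.
by apply/asboolP; exists u.
Qed.

(** The generators are L, placed at index 0, and for each nonzero residue class
    r modulo p an element y_r of minimal order in this class: an element of
    order congruent to r has the order of some L^k y_r, so its leading term
    can be cancelled. *)
Lemma curve_model : exists X : variety F p,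
  curve X /\ alg_isomorphic A (coordinate_ring X).
Proof.
have [y yP] := minimal_rep.
pose B : comAlgType F :=
  HB.pack A (GRing.PzRing_hasCommutativeMul.Build A filt_commutative).
pose r0 : 'I_p := Ordinal p_gt0.
pose x (r : 'I_p) : B := if r == r0 then L else y r.
have algB (b u : B) : b != 0 -> algebraic_mod b u.
  by move=> b0; apply: (algebraic_cofinite filt u b0 full_cofinite).
have nonunit c (v : B) : ((L : B) - c%:A) * v != 1.
  have Lc : (1 < sz (L - c%:A)%R)%N.
    rewrite ltnNge; apply/negP => le_Lc.
    have := sz_L_gt1; rewrite ltnNge -(subrK c%:A L) (leq_trans (szD filt _ _)) //.
    by rewrite geq_max le_Lc sz_alg.
  have Lc0 : L - c%:A != 0 by rewrite -(sz_gt0 filt) ltnW.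
  apply/eqP => Lcv; have v0 : (v : A) != 0.
    by apply: contra_eq_neq Lcv => ->; rewrite mulr0 eq_sym oner_neq0.
  have := szM filt Lc0 v0; rewrite [X in sz X]Lcv (sz1 filt) => e.
  have : (2 + 1 <= sz (L - c%:A)%R + sz v)%N by rewrite leq_add ?sz_gt0.
  by rewrite -e.
have dom : forall u v : B, u * v = 0 -> u = 0 \/ v = 0 by exact: filt_domain filt.
apply: (locus_model closedF algB nonunit dom) => u.
have [m] := ubnP (sz u); elim: m u => // m IHm u; rewrite ltnS => le_um.
have [->|u0] := eqVneq u 0; first by exists 0; exact: (rmorph0 (mev x)).
have [q sz_q] : exists q, sz u = sz (mev x q).
  pose r : 'I_p := Ordinal (ltn_pmod (sz u).-1 p_gt0).
  have sz_u : sz u = (sz u).-1.+1 by rewrite prednK ?sz_gt0.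
  have mevL k : mev x ('X_r0 ^+ k) = L ^+ k.
    by rewrite rmorphXn /= mevX /x eqxx.
  have [r_0|r_neq0] := eqVneq r r0.
    exists ('X_r0 ^+ ((sz u).-1 %/ p)); rewrite mevL (sz_powL _).1.
    rewrite {1}sz_u {1}(divn_eq (sz u).-1 p).
    by have /= -> := congr1 val r_0; rewrite addn0.
  have [y0 yr /(_ u u0 erefl) min_y] := yP r.
  have sz_y : sz (y r) = (sz (y r)).-1.+1 by rewrite prednK ?sz_gt0.
  have /dvdnP [k def_k] : (p %| (sz u).-1 - (sz (y r)).-1)%N.
    rewrite -eqn_mod_dvd; first by rewrite yr.
    by rewrite -ltnS -sz_u -sz_y.
  exists ('X_r0 ^+ k * 'X_r); rewrite rmorphM /= mevL mevX /x (negPf r_neq0).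
  rewrite [RHS](sz_mul_powL k y0) -def_k [in RHS]sz_y addnS subnK -?sz_u //.
  by rewrite -ltnS -sz_u -sz_y.
have [c lt_c] := sz_cancel filt u0 sz_q.
have [f def_f] := IHm _ (leq_trans lt_c le_um).
exists (f + c *: q); rewrite rmorphD -mul_mpolyC rmorphM /= mevC def_f mulr_algl.
exact: subrK.
Qed.

End Coprime.

(** Since p is prime, an order that p does not divide is prime to p. *)
Theorem prime_order_model :
  alg_isomorphic A {poly F} \/ exists X : variety F p,
    curve X /\ alg_isomorphic A (coordinate_ring X).
Proof.
have [p_dvd|/existsNP [a /not_implyP [a0 /negP p_ndvd]]] :=
  pselect (forall u, u != 0 -> (p %| (sz u).-1)%N).
  by left; apply: poly_model.
by right; apply: (curve_model a0); rewrite prime_coprime.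
Qed.

End PrimeOrder.

(** * Leading and subleading coefficients of products of operators *)

Section OperatorProduct.
Variable K : diffFieldType.
Implicit Types (P Q : {poly K}).

Lemma coef_lmulD Q k : (odo_lmulD Q)`_k.+1 = Q`_k + der Q`_k.+1.
Proof. by rewrite coefD coefMX /= coef_map. Qed.

Lemma size_iter_lmulD Q m i :
  (size Q <= m)%N -> (size (iter i (@odo_lmulD K) Q) <= i + m)%N.
Proof.
move=> le_Qm; elim: i => //= i IHi; apply/leq_sizeP => -[|k] //.
rewrite addSn ltnS => le_k; rewrite coef_lmulD.
by rewrite !nth_default ?der0 ?addr0 // (leq_trans IHi) // leqW.
Qed.

Lemma coef_iter_lmulD_lead Q m i :
  (size Q <= m.+1)%N -> (iter i (@odo_lmulD K) Q)`_(i + m) = Q`_m.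
Proof.
move=> le_Qm; elim: i => //= i IHi; rewrite addSn coef_lmulD IHi.
have := size_iter_lmulD i le_Qm; rewrite addnS => /leq_sizeP -> //.
by rewrite der0 addr0.
Qed.

(** Multiplying by X shifts the coefficients by one, so that the subleading
    coefficient, of index i + m - 1, is read at index i + m, with the value
    0 when i = m = 0. *)
Lemma coef_iter_lmulD_sub Q m i : (size Q <= m.+1)%N ->
  (iter i (@odo_lmulD K) Q * 'X)`_(i + m) = (Q * 'X)`_m + der Q`_m *+ i.
Proof.
move=> le_Qm; elim: i => [|i IHi]; first by rewrite addr0.
rewrite iterS addSn coefMX /= coefD IHi coef_map /= coef_iter_lmulD_lead //.
by rewrite mulrSr addrA.
Qed.

Lemma size_odo_mul P Q n m : (size P <= n.+1)%N -> (size Q <= m.+1)%N ->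
  (size (odo_mul P Q) <= (n + m).+1)%N.
Proof.
move=> le_P le_Q; rewrite (odo_mulE _ le_P).
apply: (leq_trans (size_sum _ _ _)); apply/bigmax_leqP => i _.
apply: leq_trans (size_scale_leq _ _) (leq_trans (size_iter_lmulD i le_Q) _).
by rewrite addnS ltnS leq_add2r -ltnS.
Qed.

Lemma coef_odo_mul_lead P Q n m : (size P <= n.+1)%N -> (size Q <= m.+1)%N ->
  (odo_mul P Q)`_(n + m) = P`_n * Q`_m.
Proof.
move=> le_P le_Q; rewrite (odo_mulE _ le_P) coef_sum big_ord_recr /= coefZ.
rewrite coef_iter_lmulD_lead // big1 ?add0r // => i _; rewrite coefZ.
rewrite [X in _ * X]nth_default ?mulr0 //.
by rewrite (leq_trans (size_iter_lmulD i le_Q)) // addnS ltn_add2r.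
Qed.

Lemma coef_odo_mul_sub P Q n m : (size P <= n.+1)%N -> (size Q <= m.+1)%N ->
  (odo_mul P Q * 'X)`_(n + m) =
  (P * 'X)`_n * Q`_m + P`_n * (Q * 'X)`_m + (P`_n * der Q`_m) *+ n.
Proof.
move=> le_P le_Q; rewrite (odo_mulE _ le_P) mulr_suml coef_sum big_ord_recr /=.
rewrite -scalerAl coefZ coef_iter_lmulD_sub // mulrDr mulrnAr addrA.
congr (_ + _ + _); case: n le_P => [|n] le_P.
  by rewrite big_ord0 coefMX mul0r.
rewrite big_ord_recr /= big1 => [|i _].
  rewrite add0r -scalerAl coefZ addSn !coefMX /= coef_iter_lmulD_lead //.
rewrite -scalerAl coefZ addSn coefMX /= [X in _ * X]nth_default ?mulr0 //.
by rewrite (leq_trans (size_iter_lmulD i le_Q)) // addnS ltn_add2r.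
Qed.

(** The products P_(n-1) Q_m and P_n Q_(m-1) contribute equally to the
    subleading coefficients of P Q and of Q P; only the terms with
    derivatives remain. *)
Lemma commuting_lead P Q n m : (size P <= n.+1)%N -> (size Q <= m.+1)%N ->
  odo_mul P Q = odo_mul Q P -> (P`_n * der Q`_m) *+ n = (Q`_m * der P`_n) *+ m.
Proof.
move=> le_P le_Q PQ; have := coef_odo_mul_sub le_P le_Q.
rewrite PQ addnC coef_odo_mul_sub // [Q`_m * (P * _)`_n]mulrC.
rewrite [P`_n * (Q * _)`_m]mulrC [X in _ = X + _ -> _]addrC.
by move=> /addrI ->.
Qed.

Lemma size_odo_mul_neq0 P Q : P != 0 -> Q != 0 ->
  (size (odo_mul P Q)).+1 = (size P + size Q)%N.
Proof.
move=> P0 Q0; have [n sP] : exists n, size P = n.+1.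
  by exists (size P).-1; rewrite prednK ?size_poly_gt0.
have [m sQ] : exists m, size Q = m.+1.
  by exists (size Q).-1; rewrite prednK ?size_poly_gt0.
have := coef_odo_mul_lead (eq_leq sP) (eq_leq sQ).
have -> : P`_n = lead_coef P by rewrite lead_coefE sP.
have -> : Q`_m = lead_coef Q by rewrite lead_coefE sQ.
move=> lead; rewrite sP sQ addSn addnS; congr _.+1.
apply/eqP; rewrite eqn_leq size_odo_mul ?sP ?sQ //= ltnNge.
apply: contraTN isT => le_sz; move/eqP: lead.
by rewrite nth_default // eq_sym mulf_eq0 !lead_coef_eq0 (negPf P0) (negPf Q0).
Qed.

End OperatorProduct.

(** * The filtration of the centralizer by the order *)

Section CentralizerFiltration.
Variable K : diffFieldType.
Hypothesis K_char0 : [pchar constants K] =i pred0.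
Variable L : odo K.
Hypothesis L_order : odo_order L != 0%N.

Lemma natr_neq0 n : (0 < n)%N -> n%:R != 0 :> K.
Proof.
move=> n0; have : n%:R != 0 :> constants K.
  by rewrite ((pcharf0P _).1 K_char0) -lt0n.
apply: contraNneq => nK; apply/eqP/val_inj; rewrite /= -[RHS]nK.
exact: (rmorph_nat (val : constants K -> K)).
Qed.

Definition centralizer_size (u : centralizer L) : nat :=
  size (centralizer_val u : {poly K}).

(** For the last clause, let a and b be the leading coefficients of two elements
    of the same order. By [commuting_lead] both have the logarithmic
    derivative (m / n) l' / l, where l is the leading coefficient of L, so a
    / b is a constant. Dividing by n uses characteristic zero. *)
Lemma centralizer_filtration : size_filtration centralizer_size.
Proof.
split.
- by move=> u; rewrite /centralizer_size size_poly_eq0 -(inj_eq val_inj).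
- by move=> u v; apply: size_polyD.
- move=> u v u0 v0; apply: size_odo_mul_neq0.
    by move: u0; rewrite -(inj_eq val_inj).
  by move: v0; rewrite -(inj_eq val_inj).
move=> [U UL] [V VL]; have LU := eqP UL; have LV := eqP VL.
rewrite -(inj_eq val_inj) /centralizer_size /=.
move=> U0 eq_sz; set n := (odo_order L).
have [m sU] : exists m, size U = m.+1.
  by exists (size U).-1; rewrite prednK ?size_poly_gt0.
have sV : size V = m.+1 by rewrite -eq_sz.
have sL : size L = n.+1.
  by move: L_order; rewrite /n /odo_order; case: (size L).
have lead_neq0 (W : {poly K}) k : size W = k.+1 -> W`_k != 0.
  by move=> sW; rewrite -[k]/(k.+1.-1) -sW lead_coef_eq0 -size_poly_eq0 sW.
have eqU := commuting_lead (eq_leq sL) (eq_leq sU) LU.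
have eqV := commuting_lead (eq_leq sL) (eq_leq sV) LV.
have l0 := lead_neq0 _ _ sL; have b0 := lead_neq0 _ _ sV.
move: eqU eqV l0 b0; set a := U`_m; set b := V`_m; set l := L`_n => eqU eqV l0 b0.
have dab : der a * b = a * der b.
  apply: (mulfI (natr_neq0 (_ : 0 < n)%N)); first by rewrite lt0n.
  apply: (mulfI l0); rewrite !mulr_natl !mulrnAr.
  have -> : (l * (der a * b)) *+ n = (l * der a) *+ n * b.
    by rewrite mulrnAl mulrA.
  have -> : (l * (a * der b)) *+ n = (l * der b) *+ n * a.
    by rewrite mulrnAl -mulrA [der b * a]mulrC.
  by rewrite eqU eqV !mulrnAl; congr (_ *+ _); ring.
have dc : der (a / b) = 0.
  apply: (mulIf b0); apply: (mulIf b0); rewrite !mul0r.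
  have da : der a = der (a / b) * b + a / b * der b by rewrite -derM divfK.
  have -> : der (a / b) * b * b = der a * b - a / b * b * der b by rewrite da; ring.
  by rewrite divfK // dab subrr.
exists (Constants (introT eqP dc)).
change (size (U - (a / b) *: V)%R < size U)%N.
rewrite sU ltnS; apply/leq_sizeP => k; rewrite leq_eqVlt => /orP [/eqP <-|lt_mk].
  by rewrite coefB coefZ -/a -/b divfK ?subrr.
by rewrite coefB coefZ !nth_default ?sU ?sV // mulr0 subr0.
Qed.

End CentralizerFiltration.

Theorem theorem1p1 (K : diffFieldType)
    (K_closed : GRing.closed_field_axiom (constants K))
    (K_char0 : [pchar constants K] =i pred0)
    (L : odo K) (L_order : odo_order L = 3%N) (L_nonconst : L \notin @constant_operators K) :
  alg_isomorphic (centralizer L) {poly constants K} \/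
  exists X : variety (constants K) 3,
    curve X /\ alg_isomorphic (centralizer L) (coordinate_ring X).
Proof.
have L_L : L \in centralizer_pred L by apply/eqP.
have filt := centralizer_filtration K_char0 (L := L).
apply: (@prime_order_model _ K_closed _ (@centralizer_size K L) _ 3 isT (Centralizer L_L)).
- by apply: filt; rewrite L_order.
- by move: L_order; rewrite /odo_order /centralizer_size /=; case: (size L) => // k /= ->.
by move=> u; apply: val_inj; apply/eqP/(centralizer_valP u).
Qed.
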